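(* Let $V$ be a strictly convex real Banach space. The binary operation $\circ$ on $V^{(\infty)} = V \times \mathbb{R}$ given by $$(u,\alpha) \circ (v,\beta) = \left(\alpha v + \beta u,\; \alpha\beta + \tfrac14\left(\|u+v\|^2 - \|u-v\|^2\right)\right)$$ is bilinear if and only if $V$ is a Hilbert space (that is, the norm of $V$ is induced by an inner product).
   Context: A normed linear space is strictly convex if the line segment joining any two points of its unit sphere does not meet the unit sphere except at its end points. $V^{(\infty)}$ denotes the real vector space $V \times \mathbb{R}$ with coordinatewise operations (ordered by the cone $\{(v,\alpha) : \|v\| \le \alpha\}$, with norm $\|(v,\alpha)\|_\infty = \|v\| + |\alpha|$). *)

(* Defs.v *)
From HB Require Import structures.
From mathcomp Require Import all_boot all_order all_algebra.
From mathcomp Require Import all_classical all_reals all_analysis.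
Set Implicit Arguments.
Unset Strict Implicit.
Unset Printing Implicit Defensive.

Import Order.TTheory GRing.Theory Num.Theory.
Import numFieldNormedType.Exports.

Local Open Scope classical_set_scope.
Local Open Scope ring_scope.

Definition unit_sphere (R : realType) (V : normedModType R) : set V :=
  [set x | `|x| = 1].

Definition line_segment (R : realType) (V : normedModType R) (x y : V)
    : set V :=
  [set (1 - t) *: x + t *: y | t in `[0, 1]].

Definition strictly_convex (R : realType) (V : normedModType R) : Prop :=
  forall x y : V, unit_sphere x -> unit_sphere y ->
    line_segment x y `&` @unit_sphere R V `<=` [set x; y].

(* An alias, so that V^(oo) carries the coordinatewise vector space structure
   but not the sup norm which the library puts on products: the norm of V^(oo)
   is `|v| + `|a|. Its norm and its order play no role in bilinearity. *)
Definition Vinf (R : realType) (V : normedModType R) : Type := (V * R^o)%type.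

HB.instance Definition _ (R : realType) (V : normedModType R) :=
  GRing.Lmodule.copy (Vinf V) (V * R^o)%type.

Definition Vinf_op (R : realType) (V : normedModType R) (p q : Vinf V)
    : Vinf V :=
  (p.2 *: q.1 + q.2 *: p.1,
   p.2 * q.2 + 4^-1 * (`|p.1 + q.1| ^+ 2 - `|p.1 - q.1| ^+ 2)).

Definition is_bilinear (R : realType) (U W : lmodType R) (f : U -> U -> W)
    : Prop :=
  bilinear_for (GRing.Scale.Law.clone _ _ *:%R _)
    (GRing.Scale.Law.clone _ _ *:%R _) f.

(* [{dot V for idfun}] is the type of symmetric positive definite bilinear
   forms on V; completeness is part of the type of V. *)
Definition is_hilbert (R : realType) (V : completeNormedModType R) : Prop :=
  exists ip : {dot V for idfun}, forall v : V, `|v| = Num.sqrt (ip v v).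

(* Main.v *)
Require Import Defs.
From HB Require Import structures.
From mathcomp Require Import all_boot all_order all_algebra ring.
From mathcomp Require Import all_classical all_reals all_analysis.
Import Order.TTheory GRing.Theory Num.Theory.
Import numFieldNormedType.Exports.
Local Open Scope ring_scope.

(** On vectors (u, 0) and (v, 0) the product of V^(oo) has zero vector part,
    and its scalar part is the polarization form
    [polar u v = (`|u + v|^2 - `|u - v|^2) / 4]. This form always satisfies
    [polar v v = `|v|^2] and is always symmetric; the only inner product axiom
    it can miss is linearity. So bilinearity of the product, restricted to
    V x 0, turns [polar] into an inner product inducing the norm
    ([is_bilinear_Vinf_op_polar], [dot_of_symmetric_linear]). Conversely an inner
    product inducing the norm is recovered from it by the polarization
    identity ([polar_dot]); then [polar] is bilinear, hence so is the product,
    whose other terms are visibly bilinear ([polar_is_bilinear_Vinf_op]). *)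

Definition polar {R : realType} {V : normedModType R} (u v : V) : R :=
  4^-1 * (`|u + v| ^+ 2 - `|u - v| ^+ 2).

Lemma polarC (R : realType) (V : normedModType R) (u v : V) :
  polar u v = polar v u.
Proof. by rewrite /polar [u + v]addrC distrC. Qed.

Lemma polarvv (R : realType) (V : normedModType R) (v : V) :
  polar v v = `|v| ^+ 2.
Proof.
rewrite /polar subrr normr0 expr0n subr0 -mulr2n normrMn.
by field.
Qed.

(** Linearity in the second variable comes for free from symmetry. *)
Lemma dot_of_symmetric_linear (R : numDomainType) (U : lmodType R)
    (f : U -> U -> R)
    (fC : forall u v, f u v = f v u)
    (fP : forall a u u' v, f (a *: u + u') v = a * f u v + f u' v)
    (f_gt0 : forall u, u != 0 -> 0 < f u u) :
  exists ip : {dot U for idfun}, forall u v, ip u v = f u v.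
Proof.
have f_bilin : bilinear_for *%R *%R f.
  by split=> u a v w /=; rewrite ?fP // !(fC u) fP.
have f_herm u v : f u v = (-1) ^+ false * idfun (f v u).
  by rewrite expr0 mul1r -fC.
pose bi := bilinear_isBilinear.Build _ _ _ _ *%R *%R f f_bilin.
pose he := isHermitianSesquilinear.Build _ _ false idfun f f_herm.
pose po := isDotProduct.Build _ _ f f_gt0.
pose ip : {dot U for idfun} := HB.pack f bi he po.
by exists ip.
Qed.

(** Expanding both squares by bilinearity, the terms [ip u u] and [ip v v]
    cancel and the four cross terms are all equal to [ip u v]. *)
Lemma polar_dot (R : realType) (V : normedModType R) (ip : {dot V for idfun})
    (ip_norm : forall v, `|v| = Num.sqrt (ip v v)) (u v : V) :
  polar u v = ip u v.
Proof.
have ip_ge0 w : 0 <= ip w w.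
  by have [->|/neq0_dnorm_gt0/ltW//] := eqVneq w 0; rewrite linear0l.
have sqr_norm w : `|w| ^+ 2 = ip w w by rewrite ip_norm sqr_sqrtr.
rewrite /polar !sqr_norm hnormD hnormB /= expr0 mul1r.
by field.
Qed.

Lemma Vinf_opC (R : realType) (V : normedModType R) (p q : Vinf V) :
  Vinf_op p q = Vinf_op q p.
Proof.
rewrite /Vinf_op -!/(polar _ _) polarC mulrC.
by rewrite addrC.
Qed.

Lemma is_bilinear_Vinf_op_polar (R : realType) (V : normedModType R) :
  is_bilinear (@Vinf_op R V) ->
  forall a (u u' v : V), polar (a *: u + u') v = a * polar u v + polar u' v.
Proof.
case=> opP _ a u u' v.
have /(congr1 snd) /= := opP (v, 0) a (u, 0) (u', 0).
rewrite /Vinf_op /= -!/(polar _ _) mulr0 mul0r !add0r; exact.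
Qed.

(** The product is commutative, so linearity on the left is enough; apart from
    [polar], its terms are products of one coordinate of each factor. *)
Lemma polar_is_bilinear_Vinf_op (R : realType) (V : normedModType R)
    (polarP : forall a (u u' v : V),
      polar (a *: u + u') v = a * polar u v + polar u' v) :
  is_bilinear (@Vinf_op R V).
Proof.
have opP q : GRing.linear_for *:%R (@Vinf_op R V ^~ q).
  move=> a p p'; rewrite /Vinf_op -!/(polar _ _); congr pair => /=.
    (* scaling in R^o is multiplication in R *)
    rewrite -[a *: p.2]/(a * p.2) scalerDl !scalerDr !scalerA.
    by rewrite [q.2 * a]mulrC addrACA.
  rewrite polarP -[a *: p.2]/(a * p.2) -[a *: (_ + _)]/(a * (_ + _)).
  by ring.
split=> p // a q r.
by rewrite !(Vinf_opC _ _ p); exact: opP.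
Qed.

Theorem theorem3p6 (R : realType) (V : completeNormedModType R)
    (hV : strictly_convex V) :
  is_bilinear (@Vinf_op R V) <-> is_hilbert V.
Proof.
split=> [/is_bilinear_Vinf_op_polar polarP | [ip ip_norm]].
- have polar_gt0 (v : V) : v != 0 -> 0 < polar v v.
    by move=> v0; rewrite polarvv exprn_gt0 ?normr_gt0.
  have [ip ipE] := dot_of_symmetric_linear _ _ _ (@polarC R V) polarP polar_gt0.
  by exists ip => v; rewrite ipE polarvv sqrtr_sqr normr_id.
- apply: polar_is_bilinear_Vinf_op => a u u' v.
  by rewrite !(polar_dot _ _ ip ip_norm) linearPl.
Qed.
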